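(* Let $T=\sum_{j=1}^{k}Q_j D^{j}$ be a degenerate exactly-solvable operator, and denote by $j_0$ the largest $j$ for which $\deg Q_j=j$. Let $p_n$ be the unique and monic $n$th degree eigenpolynomial of $T$ and let $r_n=\max\{|\alpha| : p_n(\alpha)=0\}$. Then there exists a positive constant $c>0$ such that $$\lim_{n\to\infty}\frac{r_n}{n^d}\geq c,$$ where $$d:=\max_{j\in[j_0+1,k]}\left(\frac{j-j_0}{j-\deg Q_j}\right).$$
   Context: Here $D=d/dz$. A degenerate exactly-solvable operator is a linear differential operator $T=\sum_{j=1}^{k}Q_jD^j$ of order $k$ (so $Q_k\neq 0$) whose coefficients $Q_j$ are complex polynomials in one variable $z$ with $\deg Q_j\le j$ for all $1\le j\le k$, with equality $\deg Q_j=j$ for at least one $j\in\{1,\dots,k\}$, and with $\deg Q_k<k$ for the leading term. Consequently $1\le j_0<k$. The maximum defining $d$ is over integers $j$ with $j_0+1\le j\le k$; indices $j$ with $Q_j=0$ are disregarded. An eigenpolynomial of $T$ of degree $n$ is a polynomial $p_n$ with $\deg p_n=n$ and $T(p_n)=\lambda_n p_n$ for some value $\lambda_n$ of the spectral parameter. It is a known fact that, for every such $T$, there is a unique monic eigenpolynomial $p_n$ of degree $n$ for all sufficiently large $n$, so that $r_n$ is defined for all sufficiently large $n$. *)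

(* Defs.v *)
From HB Require Import structures.
From mathcomp Require Import all_boot all_order all_algebra.
From mathcomp Require Export complex.
From mathcomp Require Import all_classical all_reals all_analysis.

Set Implicit Arguments.
Unset Strict Implicit.
Unset Printing Implicit Defensive.

Import Order.TTheory GRing.Theory Num.Theory.
Import numFieldNormedType.Exports.

Local Open Scope classical_set_scope.
Local Open Scope ring_scope.

(* The zero polynomial gets degree 0; this convention is harmless below, where
   the degree of a possibly zero polynomial is only compared with indices
   j >= 1. *)
Definition pdeg (A : nzSemiRingType) (p : {poly A}) : nat := (size p).-1.

(* The operator T = \sum_(1 <= j <= k) Q_j D^j; only the values Q_1, ..., Q_k of
   the family Q matter, here and in all the definitions that follow. *)
Definition diffop (A : comNzRingType) (k : nat) (Q : nat -> {poly A})
    (p : {poly A}) : {poly A} :=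
  \sum_(1 <= j < k.+1) Q j * p^`(j).

Definition degenerate_exactly_solvable (A : comNzRingType) (k : nat)
    (Q : nat -> {poly A}) : Prop :=
  [/\ Q k != 0,
      (forall j, (1 <= j <= k)%N -> (pdeg (Q j) <= j)%N),
      (exists2 j, (1 <= j <= k)%N & pdeg (Q j) = j)
    & (pdeg (Q k) < k)%N].

Definition last_full_degree (A : comNzRingType) (k : nat)
    (Q : nat -> {poly A}) : nat :=
  (\max_(1 <= j < k.+1 | pdeg (Q j) == j) j)%N.

(* For a degenerate exactly-solvable operator the index j = k always
   contributes, every term is positive and both truncated subtractions are
   exact, so the default value 0 of the maximum is never the result. *)
Definition growth_exponent (R : realType) (k : nat)
    (Q : nat -> {poly R[i]}) : R :=
  let j0 := last_full_degree k Q in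
  \big[Num.max/0]_(j0.+1 <= j < k.+1 | Q j != 0)
    ((j - j0)%:R / (j - pdeg (Q j))%:R).

Definition monic_eigenpoly (A : comNzRingType) (k : nat)
    (Q : nat -> {poly A}) (n : nat) (p : {poly A}) : Prop :=
  [/\ p \is monic, pdeg p = n & exists lambda : A, diffop k Q p = lambda *: p].

(* If deg p >= 1, this is the supremum of a nonempty finite set, i.e. the
   largest modulus of a root of p. *)
Definition root_radius (R : realType) (p : {poly R[i]}) : R :=
  sup [set ComplexField.Normc.normc a | a in [set a : R[i] | root p a]].

(* Main.v *)
Require Import Defs.
From mathcomp Require Import all_boot all_order all_algebra.
From mathcomp Require Import complex.
From mathcomp Require Import all_classical all_reals all_analysis.
From mathcomp Require Import ring lra zify.

Set Implicit Arguments.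
Unset Strict Implicit.
Unset Printing Implicit Defensive.

Import Order.TTheory GRing.Theory Num.Theory.
Import numFieldNormedType.Exports.

Local Open Scope classical_set_scope.
Local Open Scope ring_scope.

(** Let u_j(z) = z^j p^(j)(z) / p(z) for a monic polynomial p of degree n.
When z is far from all roots of p compared with their moduli, p behaves at z
like a power z^n, and each u_j(z) is, within a factor independent of n,
the falling factorial n^_j (far_near_ffact). Dividing T p = lambda p by p turns
the eigenvalue equation into
   lambda = sum_j Q_j(z) z^-j u_j(z),
where the j-th summand has order n^j / |z|^(j - deg Q_j).

Letting |z| tend to infinity kills every summand with deg Q_j < j, whence
|lambda| = O(n^j0) (eigenvalue_le). Now take |z| = eps n^d. By the choice of d,
all summands with j > j0 are at most of order n^j0 in n, and those for which
j attains the maximum d are exactly of this order, with a factor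
eps^-(j - deg Q_j). Among these indices, the largest one, js, also has the
largest value of j - deg Q_j (dominant_index), so for eps small its summand
dominates lambda and all the others together, contradicting the equation. Hence
z cannot be far from the roots: for all large n some root has modulus at least
c n^d, where c is eps divided by the constant that defines far. *)

(** * The modulus as a real number *)

Local Notation cabs := ComplexField.Normc.normc.
Import ComplexField.Normc.

Section Modulus.
Variable R : realType.
Implicit Types (x y z : R[i]) (n : nat).

Lemma cabsE x : (cabs x)%:C%C = `|x|.
Proof. by []. Qed.

Lemma cabs_ge0 x : 0 <= cabs x.
Proof. by rewrite -(@lecR R) cabsE normr_ge0. Qed.

Lemma cabs_gt0 x : (0 < cabs x) = (x != 0).
Proof. by rewrite -(@ltcR R) cabsE normr_gt0. Qed.

Lemma cabsD x y : cabs (x + y) <= cabs x + cabs y.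
Proof. by rewrite -(@lecR R) rmorphD /= !cabsE ler_normD. Qed.

Lemma cabsB x y : cabs x - cabs y <= cabs (x - y).
Proof. by rewrite -(@lecR R) rmorphB /= !cabsE lerB_dist. Qed.

Lemma cabsX x n : cabs (x ^+ n) = cabs x ^+ n.
Proof. by apply: (@complexI R); rewrite rmorphXn /= !cabsE normrX. Qed.

Lemma cabs_nat n : cabs (n%:R : R[i]) = n%:R.
Proof. by apply: (@complexI R); rewrite rmorph_nat /= !cabsE normr_nat. Qed.

Lemma cabs_real (a : R) : 0 <= a -> cabs a%:C%C = a.
Proof. by move=> a0; apply: (@complexI R); rewrite cabsE ger0_norm // lecR. Qed.

Lemma cabs_sum (I : Type) (s : seq I) (P : pred I) (F : I -> R[i]) :
  cabs (\sum_(i <- s | P i) F i) <= \sum_(i <- s | P i) cabs (F i).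
Proof.
by rewrite -(@lecR R) rmorph_sum /= cabsE; apply: ler_norm_sum.
Qed.
End Modulus.

(** * Logarithmic derivatives of higher order *)

Section ScaledDerivative.
Variable F : fieldType.
Implicit Types (p : {poly F}) (a z : F).

Definition scaled_deriv p z j : F := p^`(j).[z] * z ^+ j / p.[z].

Lemma derivnMXsubC p a j :
  (p * ('X - a%:P))^`(j.+1) = p^`(j) *+ j.+1 + p^`(j.+1) * ('X - a%:P).
Proof.
have := derivnMXaddC j p 0; rewrite polyC0 addr0 => E.
by rewrite !mulrBr derivnB E ![_ * a%:P]mulrC !mul_polyC derivnZ addrA.
Qed.

(** Adding one root a is the same recurrence as the one that takes n^_j.+1 to
n.+1^_j.+1 (ffactSn_add), up to the factor z / (z - a), which is close to 1
when a is small compared with z. *)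
Lemma scaled_derivMXsubC p a z j : p.[z] != 0 -> z != a ->
  scaled_deriv (p * ('X - a%:P)) z j.+1 =
  scaled_deriv p z j.+1 + j.+1%:R * (z / (z - a)) * scaled_deriv p z j.
Proof.
move=> p0; rewrite -subr_eq0 => za; rewrite /scaled_deriv derivnMXsubC.
rewrite hornerD hornerMn !hornerM hornerXsubC -[_ *+ j.+1]mulr_natl exprS.
by field; rewrite za p0.
Qed.
End ScaledDerivative.

Lemma ffactSn_add n j : (n.+1 ^_ j.+1 = n ^_ j.+1 + j.+1 * n ^_ j)%N.
Proof.
rewrite ffactSS ffactnSr; case: (leqP j n) => [jn|nj]; first by nia.
by rewrite ffact_small // !muln0.
Qed.

Section Bounds.
Variable R : realType.
Implicit Types (p : {poly R[i]}) (z : R[i]).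

(** By induction on the roots: each step of the recurrence multiplies by a
factor z / (z - a) = 1 + a / (z - a) with second summand of modulus at most
eta, and a term of index j meets at most j such factors. *)
Lemma scaled_deriv_prod (s : seq R[i]) z (eta : R) j : 0 <= eta ->
    (forall a, a \in s -> z != a) ->
    (forall a, a \in s -> cabs a <= eta * cabs (z - a)) ->
  cabs (scaled_deriv (\prod_(a <- s) ('X - a%:P)) z j - (size s ^_ j)%:R)
    <= (size s ^_ j)%:R * ((1 + eta) ^+ j - 1).
Proof.
move=> eta0; elim: s j => [|a s IH] j zs hs.
  rewrite big_nil /scaled_deriv ffact0n; case: j => [|j].
    by rewrite derivn0 hornerC !expr0 !mulr1 divr1 !subrr normc0 mulr0.
  by rewrite derivn_poly0 ?size_poly1 // horner0 !mul0r subrr normc0.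
have {}IH j' := IH j' (fun b bs => zs b (mem_behead (s := a :: s) bs))
  (fun b bs => hs b (mem_behead (s := a :: s) bs)).
set P := \prod_(b <- s) _ in IH.
have p0 : P.[z] != 0.
  rewrite -rootE root_prod_XsubC; apply/negP => zin.
  by have := zs z; rewrite inE zin orbT eqxx => /(_ isT).
have za : z != a by apply: zs; rewrite inE eqxx.
rewrite big_cons mulrC -/P /=.
case: j => [|j].
  rewrite /scaled_deriv derivn0 expr0 mulr1 divff ?ffactn0 ?subrr ?normc0 ?mulr0 //.
  by rewrite hornerM mulf_neq0 // hornerXsubC subr_eq0.
rewrite scaled_derivMXsubC // ffactSn_add natrD natrM.
have dE : z / (z - a) = 1 + a / (z - a).
  have za' : z - a != 0 by rewrite subr_eq0.
  by rewrite -(divff za') -mulrDl subrK.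
have dle : cabs (a / (z - a)) <= eta.
  rewrite normcM normcV ler_pdivrMr ?cabs_gt0 ?subr_eq0 //.
  by apply: hs; rewrite inE eqxx.
rewrite dE; move: (a / (z - a)) dle => d dle {dE}.
have := IH j; have := IH j.+1.
move: (scaled_deriv P z j) (scaled_deriv P z j.+1) => B A.
rewrite natrD natrM; move: (size s ^_ j)%N (size s ^_ j.+1)%N => N N'.
set u := A - _; set v := B - _ => hu hv.
have -> : A + j.+1%:R * (1 + d) * B - (N'%:R + j.+1%:R * N%:R) =
    u + j.+1%:R * (v + d * (v + N%:R)).
  by rewrite /u /v; ring.
apply: le_trans (cabsD _ _) _; rewrite mulrDl; apply: lerD => //.
rewrite normcM cabs_nat -mulrA ler_wpM2l ?ler0n //.
apply: le_trans (cabsD _ _) _; rewrite normcM.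
have h : cabs (v + N%:R) <= N%:R * (1 + eta) ^+ j.
  by apply: le_trans (cabsD _ _) _; rewrite cabs_nat; lra.
have := ler_pM (cabs_ge0 d) (cabs_ge0 (v + N%:R)) dle h.
rewrite exprS; move: (_ ^+ j) hv => E; nra.
Qed.

(** The chord of the convex function (1 + x)^j over [0, 1] lies above it. *)
Lemma exp1D_le (eta : R) j : 0 <= eta <= 1 ->
  (1 + eta) ^+ j <= 1 + (2 ^+ j - 1) * eta.
Proof.
move=> /andP[e0 e1]; elim: j => [|j IH]; first by rewrite !expr0 subrr mul0r addr0.
rewrite !exprS.
have h : 1 <= 2 ^+ j :> R by apply: exprn_ege1; lra.
have := ler_wpM2l (_ : 0 <= 1 + eta) IH => /(_ ltac:(lra)) h2.
apply: le_trans h2 _; move: (2 ^+ j) h => E h.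
have : 0 <= (E - 1) * (eta * (1 - eta)) by rewrite !mulr_ge0; lra.
lra.
Qed.

Lemma root_le_radius p a : p != 0 -> root p a -> cabs a <= root_radius p.
Proof.
move=> p0 pa; apply: ub_le_sup; last by exists a.
have [s sE] := closed_field_poly_normal p.
exists (\sum_(b <- s) cabs b) => _ [b pb <-].
have bs : b \in s.
  move: pb => /=; rewrite sE rootZ ?lead_coef_eq0 // root_prod_XsubC //.
by rewrite (big_rem b) //= lerDl; apply: sumr_ge0 => *; apply: cabs_ge0.
Qed.

(** The factor 1/2 is uniform in the degree of p, which is what makes
the estimates below survive the passage to large degrees. *)
Definition near_ffact k p z := forall j, (j <= k)%N ->
  cabs (scaled_deriv p z j - ((size p).-1 ^_ j)%:R) <= ((size p).-1 ^_ j)%:R / 2.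

(** With eta = 2^-(k+1), the hypothesis on z puts every root a within
eta * |z - a| of the origin, and (1 + eta)^j <= 3/2 for all j <= k. *)
Lemma far_near_ffact k p z : p \is monic ->
  0 < cabs z -> root_radius p * (1 + 2 ^+ k.+1) <= cabs z ->
  p.[z] != 0 /\ near_ffact k p z.
Proof.
move=> pm z0 hz; set eta : R := (2 ^+ k.+1)^-1.
have E0 : 0 < 2 ^+ k.+1 :> R by apply: exprn_gt0.
have e0 : 0 < eta by rewrite invr_gt0.
have p0 := monic_neq0 pm.
have hr a : root p a -> cabs a <= eta * cabs (z - a).
  move=> /(root_le_radius p0) ra; rewrite mulrC ler_pdivlMr //.
  have := cabsB z a; nra.
have za a : root p a -> z != a.
  move=> pa; apply/eqP => za; have := hr a pa.
  by rewrite za subrr normc0 mulr0 -za leNgt z0.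
have [s] := closed_field_poly_normal p; rewrite (monicP pm) scale1r => sE.
have ps a : a \in s -> root p a by rewrite sE root_prod_XsubC.
have szp : (size p).-1 = size s by rewrite sE size_prod_XsubC.
split; first by rewrite -rootE; apply/negP => /za; rewrite eqxx.
rewrite /near_ffact szp => j jk; rewrite sE.
have h := @scaled_deriv_prod s z eta j (ltW e0) (fun a as_ => za a (ps a as_))
  (fun a as_ => hr a (ps a as_)).
apply: le_trans h _.
apply: ler_wpM2l; first exact: ler0n.
have e1 : eta <= 1 by rewrite invf_le1 // exprn_ege1 //; lra.
have := @exp1D_le eta j; rewrite (ltW e0) e1 => /(_ isT).
have : 2 ^+ j * eta <= 2^-1.
  rewrite /eta ler_pdivrMr // exprS mulrA mulVf ?mul1r; last by lra.
  by rewrite ler_weXn2l //; lra.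
lra.
Qed.
End Bounds.

(** * Size of a polynomial far from the origin *)

Section PolynomialGrowth.
Variable R : realType.
Implicit Types (q : {poly R[i]}) (z : R[i]).

Definition coef_norm q : R := \sum_(i < size q) cabs q`_i.

Lemma coef_norm_ge0 q : 0 <= coef_norm q.
Proof. by apply: sumr_ge0 => i _; apply: cabs_ge0. Qed.

Lemma horner_le q z : 1 <= cabs z ->
  cabs q.[z] <= coef_norm q * cabs z ^+ pdeg q.
Proof.
move=> z1; rewrite horner_coef /coef_norm mulr_suml.
apply: le_trans (cabs_sum _ _ _) _; apply: ler_sum => i _.
rewrite normcM cabsX ler_wpM2l ?cabs_ge0 // ler_weXn2l //.
by have := ltn_ord i; rewrite /pdeg; lia.
Qed.

(** Once |z| is large the leading monomial is at least twice the sum of the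
others, so half its modulus remains. *)
Lemma horner_ge q : q != 0 -> exists2 l : R, 0 < l &
  exists A, forall z, A <= cabs z -> l * cabs z ^+ pdeg q <= cabs q.[z].
Proof.
move=> q0; set l := cabs (lead_coef q) / 2.
have l0 : 0 < l by rewrite divr_gt0 ?cabs_gt0 ?lead_coef_eq0.
exists l => //; exists (1 + coef_norm q / l) => z hz.
have B0 := coef_norm_ge0 q.
have Bl : coef_norm q / l <= cabs z by lra.
have z1 : 1 <= cabs z by have : 0 <= coef_norm q / l by [rewrite divr_ge0 // ltW|]; lra.
rewrite ler_pdivrMr // in Bl.
have sE : size q = (pdeg q).+1 by rewrite /pdeg prednK // size_poly_gt0.
rewrite horner_coef sE big_ord_recr /= addrC.
set S := \sum_(i < _) _.
have SB : cabs S * cabs z <= coef_norm q * cabs z ^+ pdeg q.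
  rewrite /S /coef_norm sE big_ord_recr /= mulrDl.
  apply: (@le_trans _ _ (\sum_(i < pdeg q) cabs q`_i * cabs z ^+ pdeg q)).
    apply: le_trans (ler_wpM2r (cabs_ge0 z) (cabs_sum _ _ _)) _.
    rewrite mulr_suml; apply: ler_sum => i _.
    rewrite normcM cabsX -mulrA -exprSr ler_wpM2l ?cabs_ge0 // ler_weXn2l //.
  by rewrite mulr_suml lerDl mulr_ge0 ?cabs_ge0 // exprn_ge0 // cabs_ge0.
have Sl : cabs S <= l * cabs z ^+ pdeg q.
  have z0 : 0 < cabs z by lra.
  rewrite -(ler_pM2r z0); apply: le_trans SB _.
  by rewrite [leRHS]mulrAC [l * _]mulrC ler_wpM2r // exprn_ge0 // cabs_ge0.
have := cabsB (q`_(pdeg q) * z ^+ pdeg q) (- S); rewrite opprK normcN normcM cabsX.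
have -> : cabs q`_(pdeg q) = 2 * l by rewrite /l mulrC divfK.
lra.
Qed.
End PolynomialGrowth.

(** * The eigenvalue equation divided by the eigenpolynomial *)

Section Eigenvalue.
Variables (R : realType) (k : nat) (Q : nat -> {poly R[i]}).
Implicit Types (p : {poly R[i]}) (z : R[i]).

Definition eigen_term p z j : R[i] := (Q j).[z] / z ^+ j * scaled_deriv p z j.

Lemma eigenvalue_sum p z (lambda : R[i]) :
  diffop k Q p = lambda *: p -> p.[z] != 0 -> z != 0 ->
  lambda = \sum_(1 <= j < k.+1) eigen_term p z j.
Proof.
move=> /(congr1 (fun q => q.[z])); rewrite /diffop horner_sum hornerZ => E p0 z0.
rewrite -[LHS](mulfK p0) -E mulr_suml; apply: eq_bigr => j _.
have zj : z ^+ j != 0 by rewrite expf_neq0.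
rewrite /eigen_term /scaled_deriv hornerM.
move: (Q j).[z] (p^`(j).[z]) (z ^+ j) zj (p.[z]) p0 => a b c c0 d d0.
by rewrite !mulrA; congr (_ / d); rewrite mulrAC divfK.
Qed.

Lemma eigen_term_le p z j : near_ffact k p z -> 1 <= cabs z ->
  (pdeg (Q j) <= j <= k)%N ->
  cabs (eigen_term p z j) <=
    2 * coef_norm (Q j) * (pdeg p)%:R ^+ j / cabs z ^+ (j - pdeg (Q j)).
Proof.
move=> near z1 /andP[qj jk]; have := near j jk; rewrite -/(pdeg p).
set u := scaled_deriv p z j; set F : R := (_ ^_ j)%:R => hu.
have FN : F <= (pdeg p)%:R ^+ j.
  rewrite /F -natrX ler_nat ffact_prod -[X in (_ <= _ ^ X)%N](card_ord j).
  by rewrite -prod_nat_const leq_prod // => i _; apply: leq_subr.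
have F0 : 0 <= F by apply: ler0n.
have uN : cabs u <= 2 * (pdeg p)%:R ^+ j.
  have := cabsB u (- ((pdeg p) ^_ j)%:R); have := cabsB u ((pdeg p) ^_ j)%:R.
  by rewrite cabs_nat; lra.
have z0 : 0 < cabs z by lra.
have zE : cabs z ^+ j = cabs z ^+ pdeg (Q j) * cabs z ^+ (j - pdeg (Q j)).
  by rewrite -exprD subnKC.
rewrite /eigen_term -/u 2!normcM normcV cabsX.
have := ler_pM (cabs_ge0 _) (cabs_ge0 u) (horner_le (Q j) z1) uN.
rewrite zE; set a := cabs z ^+ pdeg _; set b := cabs z ^+ _ => h.
have a0 : 0 < a by apply: exprn_gt0.
have b0 : 0 < b by apply: exprn_gt0.
rewrite mulrAC ler_pdivrMr ?mulr_gt0 // mulrCA divfK ?gt_eqF //.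
by apply: le_trans h _; lra.
Qed.

Definition total_coef_norm : R := \sum_(1 <= j < k.+1) coef_norm (Q j).

(** The eigenvalue does not depend on the point where the equation is
evaluated. At a point of modulus at least n^k the summands of index greater
than j0 are bounded, and the others have order at most n^j0. *)
Lemma eigenvalue_le p (lambda : R[i]) j0 :
    p \is monic -> (0 < pdeg p)%N -> diffop k Q p = lambda *: p ->
    (forall j, (1 <= j <= k)%N -> (pdeg (Q j) <= j)%N) ->
    (forall j, (j0 < j <= k)%N -> (pdeg (Q j) < j)%N) ->
  cabs lambda <= 2 * total_coef_norm * (pdeg p)%:R ^+ j0.
Proof.
move=> pm n0 E le_deg lt_deg.
(* A radius far from the roots and at least n^k. *)
set rho : R := 1 + (pdeg p)%:R ^+ k + `|root_radius p * (1 + 2 ^+ k.+1)|.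
have nk : 1 <= (pdeg p)%:R ^+ k :> R by rewrite exprn_ege1 // ler1n.
have r0 : 0 <= `|root_radius p * (1 + 2 ^+ k.+1)| by [].
have rho1 : 1 <= rho by rewrite /rho; lra.
have zE : cabs (rho%:C)%C = rho by rewrite cabs_real //; lra.
have [||p0 near] := @far_near_ffact _ k p (rho%:C)%C pm.
- by rewrite zE; lra.
- by rewrite zE /rho; have := ler_norm (root_radius p * (1 + 2 ^+ k.+1)); lra.
have z0 : (rho%:C)%C != 0 by rewrite -cabs_gt0 zE; lra.
rewrite (eigenvalue_sum E p0 z0).
apply: le_trans (cabs_sum _ _ _) _.
rewrite /total_coef_norm mulr_sumr mulr_suml !big_nat.
apply: ler_sum => j hj.
have jk : (1 <= j <= k)%N by lia.
apply: le_trans (eigen_term_le near _ _) _.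
- by rewrite zE.
- by rewrite le_deg //; lia.
rewrite zE -!mulrA ler_wpM2l // ler_wpM2l ?coef_norm_ge0 //.
rewrite ler_pdivrMr ?exprn_gt0 //; last by lra.
have n1 : 1 <= (pdeg p)%:R :> R by rewrite ler1n.
case: (leqP j j0) => [jj0|j0j].
  apply: (@le_trans _ _ ((pdeg p)%:R ^+ j0)); first by rewrite ler_weXn2l.
  by rewrite ler_peMr ?exprn_ge0 // exprn_ege1.
apply: (@le_trans _ _ rho).
  apply: (@le_trans _ _ ((pdeg p)%:R ^+ k)); last by rewrite /rho; lra.
  by rewrite ler_weXn2l //; lia.
apply: (@le_trans _ _ (rho ^+ (j - pdeg (Q j)))).
  by rewrite -[X in X <= _]expr1 ler_weXn2l //; have := lt_deg j; lia.
by rewrite ler_peMl ?exprn_ge0 ?exprn_ege1 //; lra.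
Qed.
End Eigenvalue.

(** * The growth exponent and the dominant index *)

Section Exponents.
Variables (R : realType) (k : nat) (Q : nat -> {poly R[i]}).
Hypothesis HQ : degenerate_exactly_solvable k Q.

Local Notation j0 := (last_full_degree k Q).
Local Notation d := (growth_exponent k Q).

Lemma last_full_degree_lt : (j0 < k)%N.
Proof.
have [_ _ [j jk jdeg] degk] := HQ.
have k0 : (0 < k)%N by lia.
rewrite -[X in (_ < X)%N](prednK k0) ltnS; apply/bigmax_leqP_seq => i.
rewrite mem_index_iota => hi /eqP iE.
have : i <> k by move=> ik; move: degk; rewrite -{1}ik iE ik ltnn.
by lia.
Qed.

Lemma pdeg_lt j : (j0 < j <= k)%N -> (pdeg (Q j) < j)%N.
Proof.
have [_ le_deg _ _] := HQ.
move=> jk; rewrite ltn_neqAle le_deg ?andbT; last by lia.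
apply/negP => jdeg; suff : (j <= j0)%N by lia.
apply: (@leq_bigmax_seq _ (index_iota 1 k.+1) _ id) => //.
by rewrite mem_index_iota; lia.
Qed.

Let ratio j : R := (j - j0)%:R / (j - pdeg (Q j))%:R.

Lemma gap_le j : (j0 < j <= k)%N -> Q j != 0 ->
  (j - j0)%:R <= d * (j - pdeg (Q j))%:R.
Proof.
move=> jk Qj; rewrite -ler_pdivrMr; last by rewrite ltr0n subn_gt0 pdeg_lt.
by apply: (@le_bigmax_seq _ _ _ _ 0 j (fun i => Q i != 0) ratio) => //; rewrite mem_index_iota; lia.
Qed.

Lemma growth_exponent_gt0 : 0 < d.
Proof.
have [Qk _ _ _] := HQ; have k0 := last_full_degree_lt.
have := @gap_le k; rewrite k0 leqnn => /(_ isT Qk).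
have : 0 < (k - j0)%:R :> R by rewrite ltr0n subn_gt0.
move=> h1 h2; have := lt_le_trans h1 h2; rewrite pmulr_lgt0 // ltr0n subn_gt0.
by rewrite pdeg_lt // k0 leqnn.
Qed.

Lemma growth_exponent_attained :
  exists2 j, (j0 < j <= k)%N && (Q j != 0) & ratio j = d.
Proof.
have := growth_exponent_gt0; rewrite /growth_exponent big_nat_cond -/ratio.
pose P (x : R) := x > 0 -> exists2 j, (j0 < j <= k)%N && (Q j != 0) & ratio j = x.
apply: (big_ind P) => [|x y Px Py|j hj _].
- by rewrite /P ltxx.
- by rewrite /P maxEle; case: ifP.
- by exists j => //; move: hj; rewrite ltnS.
Qed.

(** The largest index js attaining the maximum d. As j - j0 = d (j - deg Q_j)
whenever j attains it, a smaller such j has a smaller j - deg Q_j. The second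
alternative of the last clause thus carries a smaller power of 1 / eps,
the first one a smaller power of n. *)
Lemma dominant_index : exists js,
  [/\ (j0 < js <= k)%N, Q js != 0,
      d * (js - pdeg (Q js))%:R = (js - j0)%:R
    & forall j, (j0 < j <= k)%N -> Q j != 0 -> j != js ->
        (j - j0)%:R < d * (j - pdeg (Q j))%:R \/
        d * (j - pdeg (Q j))%:R = (j - j0)%:R /\
        (j - pdeg (Q j) < js - pdeg (Q js))%N].
Proof.
pose P j := (j0 < j <= k)%N && (Q j != 0) && (ratio j == d).
have exP : exists j, P j.
  by have [j hj /eqP rj] := growth_exponent_attained; exists j; rewrite /P hj.
have ubP j : P j -> (j <= k)%N by move=> /andP[/andP[/andP[]]].
have PE j : P j -> d * (j - pdeg (Q j))%:R = (j - j0)%:R.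
  move=> /andP[/andP[jk _] /eqP <-]; rewrite divfK // pnatr_eq0.
  by have := pdeg_lt jk; lia.
case: (ex_maxnP exP ubP) => js Pjs maxjs.
have /andP[/andP[jsk Qjs] _] := Pjs.
exists js; split => // [|j jk Qj jjs]; first exact: PE.
have := gap_le jk Qj; rewrite le_eqVlt => /predU1P[jE|]; [right|by left].
split => //.
have Pj : P j.
  rewrite /P jk Qj /= /ratio jE mulfK // pnatr_eq0.
  by have := pdeg_lt jk; lia.
have jlt : (j < js)%N by rewrite ltn_neqAle jjs maxjs.
rewrite -(ltr_nat R) -(ltr_pM2l growth_exponent_gt0) -jE (PE _ Pjs) ltr_nat.
by lia.
Qed.
End Exponents.

(** * Limits along the integers *)

Section Limits.
Variable R : realType.

Lemma near_powR_ge (s K : R) : 0 < s -> \forall n \near \oo, K <= n%:R `^ s.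
Proof.
move=> s0; near=> n.
have h : `|K| `^ s^-1 <= n%:R by near: n; exact: nbhs_infty_ger.
apply: (@le_trans _ _ `|K|); first exact: ler_norm.
have := ge0_ler_powR (ltW s0) _ _ h; rewrite !nnegrE powR_ge0 ler0n.
by rewrite -powRrM mulVf ?gt_eqF // powRr1 // => ->.
Unshelve. all: by end_near.
Qed.

Lemma limn_einf_ge (u : (\bar R)^nat) (c : \bar R) :
  (\forall n \near \oo, (c <= u n)%E) -> (c <= limn_einf u)%E.
Proof.
move=> [N _ hN]; rewrite limn_einf_lim; apply: lime_ge; first exact: is_cvg_einfs.
exists N => // n /= Nn; apply: le_ereal_inf_tmp => _ [m /= nm <-].
by apply: hN => /=; apply: leq_trans nm.
Qed.
End Limits.

(** * Comparison of the summands *)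

Lemma ffact_ge (R : realType) n j : (2 * j <= n)%N ->
  (n%:R / 2) ^+ j <= (n ^_ j)%:R :> R.
Proof.
move=> jn; rewrite ffact_prod natr_prod -[X in _ ^+ X](card_ord j) -prodr_const.
apply: ler_prod => i _; rewrite divr_ge0 ?ler0n //= natrB; last first.
  by have := ltn_ord i; lia.
have : (i + i)%:R <= n%:R :> R by rewrite ler_nat; have := ltn_ord i; lia.
by rewrite natrD; lra.
Qed.

(** If the eigenvalue and all summands but one are small, so is the remaining
one. The factor w measures smallness relative to n^j0. *)
Lemma dominant_term_le (R : realType) k (Q : nat -> {poly R[i]}) (p : {poly R[i]})
    (lambda z : R[i]) j0 js (w : R) :
    diffop k Q p = lambda *: p -> p.[z] != 0 -> near_ffact k p z ->
    1 <= cabs z ->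
    (forall j, (1 <= j <= k)%N -> (pdeg (Q j) <= j)%N) ->
    (1 <= js <= k)%N -> 0 <= w ->
    (forall j, (1 <= j <= k)%N -> Q j != 0 -> j != js ->
      (pdeg p)%:R ^+ j / cabs z ^+ (j - pdeg (Q j)) <= (pdeg p)%:R ^+ j0 * w) ->
    cabs lambda <= 2 * total_coef_norm k Q * (pdeg p)%:R ^+ j0 * w ->
  cabs (eigen_term Q p z js) <= 4 * total_coef_norm k Q * (pdeg p)%:R ^+ j0 * w.
Proof.
move=> E p0 near z1 le_deg jsk w0 small lambda_le.
have z0 : z != 0 by rewrite -cabs_gt0; lra.
have := eigenvalue_sum E p0 z0.
have jsin : js \in index_iota 1 k.+1 by rewrite mem_index_iota; lia.
rewrite (big_rem js) //=; set S := \sum_(_ <- _) _ => lE.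
have -> : eigen_term Q p z js = lambda - S by rewrite lE addrK.
apply: le_trans (cabsD _ _) _; rewrite normcN.
have : cabs S <= 2 * total_coef_norm k Q * (pdeg p)%:R ^+ j0 * w.
  apply: le_trans (cabs_sum _ _ _) _.
  apply: (@le_trans _ _ (\sum_(j <- rem js (index_iota 1 k.+1))
     2 * coef_norm (Q j) * (pdeg p)%:R ^+ j0 * w)); last first.
    rewrite -!mulr_suml -mulr_sumr /total_coef_norm (big_rem js jsin) /=.
    do 2 (apply: ler_wpM2r; [by rewrite ?exprn_ge0|]).
    by rewrite ler_pM2l // lerDr coef_norm_ge0.
  rewrite big_seq [leRHS]big_seq; apply: ler_sum => j.
  rewrite mem_rem_uniq ?iota_uniq // inE /= mem_index_iota => /andP[jjs jk].
  have jk' : (1 <= j <= k)%N by lia.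
  apply: le_trans (eigen_term_le near z1 _) _; first by rewrite le_deg //; lia.
  rewrite -!mulrA ler_wpM2l //; have [Qj0|Qj] := eqVneq (Q j) 0.
    by rewrite /coef_norm Qj0 size_poly0 big_ord0 !mul0r.
  by rewrite ler_wpM2l ?coef_norm_ge0 // small.
lra.
Qed.

Lemma eigen_term_ge (R : realType) k (Q : nat -> {poly R[i]}) (p : {poly R[i]})
    (z : R[i]) j (l : R) :
    near_ffact k p z -> 0 < cabs z -> 0 < l ->
    (pdeg (Q j) <= j <= k)%N -> (2 * j <= pdeg p)%N ->
    l * cabs z ^+ pdeg (Q j) <= cabs (Q j).[z] ->
  l / 2 ^+ k.+1 * ((pdeg p)%:R ^+ j / cabs z ^+ (j - pdeg (Q j)))
    <= cabs (eigen_term Q p z j).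
Proof.
move=> near z0 l0 /andP[degj jk] jn Ql.
have := near j jk; rewrite -/(pdeg p); have := ffact_ge R jn.
set u := scaled_deriv p z j => hF hu.
have uN : (pdeg p)%:R ^+ j / 2 ^+ k.+1 <= cabs u.
  apply: (@le_trans _ _ (((pdeg p)%:R / 2) ^+ j / 2)).
    rewrite expr_div_n -mulrA ler_wpM2l ?exprn_ge0 //.
    rewrite -invfM -exprSr lef_pV2 ?posrE ?exprn_gt0 //.
    by rewrite ler_weXn2l //; lra.
  have := cabsB ((pdeg p) ^_ j)%:R ((pdeg p ^_ j)%:R - u).
  have -> : cabs ((pdeg p ^_ j)%:R - u) = cabs (u - (pdeg p ^_ j)%:R).
    by rewrite -normcN opprB.
  rewrite subKr cabs_nat.
  by move: hF hu; set F : R := (_ ^_ j)%:R; lra.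
have N0 : 0 <= (pdeg p)%:R ^+ j / 2 ^+ k.+1 :> R by rewrite divr_ge0 ?exprn_ge0.
have lz0 : 0 <= l * cabs z ^+ pdeg (Q j) by rewrite mulr_ge0 ?exprn_ge0 ?ltW.
have h := ler_pM lz0 N0 Ql uN.
rewrite /eigen_term -/u 2!normcM normcV cabsX.
rewrite [leRHS]mulrAC ler_pdivlMr ?exprn_gt0 //; apply: le_trans h.
have -> : cabs z ^+ j = cabs z ^+ pdeg (Q j) * cabs z ^+ (j - pdeg (Q j)).
  by rewrite -exprD subnKC.
have b0 : cabs z ^+ (j - pdeg (Q j)) != 0 by rewrite expf_neq0 // gt_eqF.
have c0 : 2 ^+ k.+1 != 0 :> R by rewrite expf_neq0.
set b := cabs z ^+ (j - _) in b0 *; set c := 2 ^+ _ in c0 *.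
set N := _%:R ^+ j; set a := cabs z ^+ _.
suff -> : l / c * (N / b) * (a * b) = l * a * (N / c) by [].
by field; rewrite b0 c0.
Qed.

Lemma powR_split (R : realType) (x : R) i j : 0 < x -> (i <= j)%N ->
  x ^+ j = x ^+ i * x `^ (j - i)%:R.
Proof. by move=> x0 ij; rewrite powR_mulrn ?ltW // -exprD subnKC. Qed.

Lemma powR_exprn (R : realType) (x d : R) e : (x `^ d) ^+ e = x `^ (d * e%:R).
Proof. by rewrite powRrM powR_mulrn // powR_ge0. Qed.

(** The weight of a summand at modulus eps x^d, where x^(d e - (j - i)) is
the gain in the degree when j does not attain the maximum: it then absorbs
eps^-e. When j attains the maximum, e < es leaves at least one factor eps. *)
Lemma subdominant_le (R : realType) (x d eps : R) i j e es :
    1 <= x -> 0 < eps <= 1 -> (i < j)%N -> (0 < es)%N ->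
    eps ^- e <= x `^ (d * e%:R - (j - i)%:R) \/
      d * e%:R = (j - i)%:R /\ (e < es)%N ->
  x ^+ j / (eps * x `^ d) ^+ e <= x ^+ i * (eps / eps ^+ es).
Proof.
move=> x1 /andP[eps0 eps1] ij es0 cmp.
have x0 : 0 < x by lra.
have ee0 : 0 < eps ^+ e by apply: exprn_gt0.
rewrite (powR_split x0 (ltnW ij)) -mulrA ler_pM2l ?exprn_gt0 // exprMn powR_exprn.
rewrite ler_pdivrMr ?mulr_gt0 ?powR_gt0 //; case: cmp => [gap|[-> ees]].
  have -> : x `^ (d * e%:R) = x `^ (j - i)%:R * x `^ (d * e%:R - (j - i)%:R).
    by rewrite -powRD ?(gt_eqF x0) ?implybT // addrC subrK.
  rewrite -[_^-1]mul1r ler_pdivrMr // mulrC in gap.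
  have w1 : 1 <= eps / eps ^+ es.
    by rewrite ler_pdivlMr ?exprn_gt0 // mul1r -[leRHS]expr1 ler_wiXn2l // ltW.
  rewrite mulrA mulrCA ler_peMr ?powR_ge0 //.
  by rewrite -mulrA; apply: mulr_ege1.
rewrite mulrA ler_peMl ?powR_ge0 // mulrAC ler_pdivlMr ?exprn_gt0 // mul1r -exprS.
by rewrite ler_wiXn2l // ltW.
Qed.

(** * The lower bound on the root radius *)

Theorem mainTheorem1 (R : realType) (k : nat) (Q : nat -> {poly R[i]})
    (p : nat -> {poly R[i]}) :
  degenerate_exactly_solvable k Q ->
  (\forall n \near \oo, monic_eigenpoly k Q n (p n)) ->
  exists2 c : R, 0 < c &
    (c%:E <= limn_einf (fun n : nat =>
       (root_radius (p n) / (n%:R `^ growth_exponent k Q))%:E))%E.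
Proof.
move=> HQ Hp.
have [js [jsk Qjs dE others]] := dominant_index HQ.
have [_ le_deg _ _] := HQ.
have d0 := growth_exponent_gt0 HQ.
have lt_deg := @pdeg_lt _ _ _ HQ.
move: others dE d0 lt_deg jsk.
set d := growth_exponent k Q; set j0 := last_full_degree k Q.
move=> others dE d0 lt_deg jsk.
have [l l0 [A QA]] := horner_ge Qjs.
set es := (js - pdeg (Q js))%N in dE others.
have es0 : (0 < es)%N by have := lt_deg js jsk; rewrite /es; lia.
have js1 : (1 <= js <= k)%N by lia.
have js_deg : (pdeg (Q js) <= js <= k)%N by rewrite le_deg //; lia.
have [jsj0 js_le] := andP jsk.
set B := total_coef_norm k Q.
have B0 : 0 <= B by apply: sumr_ge0 => j _; apply: coef_norm_ge0.
set l' := l / 2 ^+ k.+1.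
have l'0 : 0 < l' by rewrite divr_gt0 ?exprn_gt0.
(* This makes the upper bound 4 B eps for the dominant summand smaller than its
   lower bound l', in units of n^j0 / eps^es. *)
set eps := Num.min 1 (l' / (4 * B + 1)).
have B1 : 0 < 4 * B + 1 by lra.
have eps0 : 0 < eps by rewrite lt_min ltr01 divr_gt0.
have eps1 : eps <= 1 by rewrite ge_min lexx.
have epsB : 4 * B * eps < l'.
  have : eps <= l' / (4 * B + 1) by rewrite ge_min lexx orbT.
  by rewrite ler_pdivlMr //; lra.
(* A point of modulus at least M times the root radius is far from the roots. *)
set M : R := 1 + 2 ^+ k.+1.
have M0 : 0 < M by rewrite ltr_wpDr ?exprn_ge0.
exists (eps / M); first by rewrite divr_gt0.
apply: limn_einf_ge.
have gaps : \forall n \near \oo, forall j : 'I_k.+1,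
    (j0 < j)%N -> (j - j0)%:R < d * (j - pdeg (Q j))%:R ->
    eps ^- (j - pdeg (Q j)) <= n%:R `^ (d * (j - pdeg (Q j))%:R - (j - j0)%:R).
  apply: filter_forall => j.
  have [h|h] := ltP (j - j0)%:R (d * (j - pdeg (Q j))%:R); last first.
    by near=> n => _.
  rewrite -subr_gt0 in h.
  by apply: filterS (near_powR_ge (eps ^- (j - pdeg (Q j))) h) => n ? _ _.
near=> n.
have [pm pn [lambda E]] : monic_eigenpoly k Q n (p n) by near: n.
have n2k : (2 * k <= n)%N by near: n; exact: nbhs_infty_ge.
have n0 : (0 < n)%N by near: n; exact: nbhs_infty_gt.
have nd : Num.max 1 A / eps <= n%:R `^ d by near: n; exact: near_powR_ge.
have gaps_n : forall j : 'I_k.+1,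
    (j0 < j)%N -> (j - j0)%:R < d * (j - pdeg (Q j))%:R ->
    eps ^- (j - pdeg (Q j)) <= n%:R `^ (d * (j - pdeg (Q j))%:R - (j - j0)%:R).
  by near: n.
have nR0 : 0 < n%:R :> R by rewrite ltr0n.
have nR1 : 1 <= n%:R :> R by rewrite ler1n.
set N := n%:R `^ d in nd *.
have N0 : 0 < N by apply: powR_gt0.
rewrite lee_fin leNgt; apply/negP => r_small.
pose rho := eps * N.
have rhoA : Num.max 1 A <= rho by rewrite /rho mulrC -ler_pdivrMr.
have rho1 : 1 <= rho by apply: le_trans rhoA; rewrite le_max lexx.
have [z zE] : exists z : R[i], cabs z = rho.
  by exists (rho%:C)%C; rewrite cabs_real //; lra.
have [||p0 near] := @far_near_ffact _ k (p n) z pm.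
- by rewrite zE; lra.
- rewrite zE -/M -ler_pdivlMr // /rho mulrAC -ler_pdivrMr //; exact: ltW.
(* The modulus of the dominant summand is of order n^j0 / eps^es; everything else
   is at most of order eps times that. *)
pose w := eps / eps ^+ es.
have w1 : 1 <= w.
  rewrite /w ler_pdivlMr ?exprn_gt0 // mul1r -[leRHS]expr1.
  by rewrite ler_wiXn2l // ltW.
have w0 : 0 <= w by lra.
have nj0 : 0 < n%:R ^+ j0 :> R by apply: exprn_gt0.
have small j : (1 <= j <= k)%N -> Q j != 0 -> j != js ->
    n%:R ^+ j / rho ^+ (j - pdeg (Q j)) <= n%:R ^+ j0 * w.
  move=> jk Qj jjs; have [jj0|jj0] := leqP j j0.
    apply: (@le_trans _ _ (n%:R ^+ j0 * 1)); last by rewrite ler_pM2l.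
    rewrite mulr1 ler_pdivrMr ?exprn_gt0 //; last by lra.
    apply: (@le_trans _ _ (n%:R ^+ j0)); first by rewrite ler_weXn2l.
    by rewrite ler_peMr ?exprn_ege1 // ltW.
  have jk' : (j0 < j <= k)%N by rewrite jj0; case/andP: jk.
  apply: subdominant_le => //; first by rewrite eps0.
  case: (others j jk' Qj jjs) => [gap|]; [left|by right].
  have jk1 : (j < k.+1)%N by case/andP: jk.
  exact: gaps_n (Ordinal jk1) jj0 gap.
have lambda_le : cabs lambda <= 2 * B * n%:R ^+ j0 * w.
  have nz : (0 < pdeg (p n))%N by rewrite pn.
  have := eigenvalue_le pm nz E le_deg lt_deg; rewrite pn -/B => h.
  by apply: le_trans h _; rewrite ler_peMr // ?mulr_ge0 //; exact: ltW.
have upper := @dominant_term_le R k Q (p n) lambda z j0 js w E p0 near.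
rewrite zE pn in upper.
have {}upper := upper rho1 le_deg js1 w0 small lambda_le.
have lower := @eigen_term_ge R k Q (p n) z js l near.
rewrite zE pn -/l' -/es in lower.
have {}lower : l' * (n%:R ^+ js / rho ^+ es) <= cabs (eigen_term Q (p n) z js).
  apply: (lower (lt_le_trans ltr01 rho1) l0) => //.
    by apply: leq_trans n2k; rewrite leq_mul2l.
  by rewrite -zE; apply: QA; rewrite zE; apply: le_trans rhoA; rewrite le_max lexx orbT.
have eqn : n%:R ^+ js / rho ^+ es = n%:R ^+ j0 / eps ^+ es.
  rewrite (powR_split nR0 (ltnW jsj0)) /rho exprMn powR_exprn dE.
  have P0 : n%:R `^ (js - j0)%:R != 0 :> R by rewrite gt_eqF ?powR_gt0.
  by rewrite invfM mulrA mulrAC mulfK.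
have := le_trans lower upper; rewrite eqn /w !mulrA.
rewrite ler_pM2r ?invr_gt0 ?exprn_gt0 // [4 * B * _ * _]mulrAC ler_pM2r //.
by rewrite leNgt epsB.
Unshelve. all: by end_near.
Qed.
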